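(* Let $N(d)$ denote the maximum number of equiangular lines in the $d$-dimensional Euclidean space $\mathbb{R}^d$. Then $N(18)\geq 54$.
   Context: A set of $n$ (pairwise distinct) lines through the origin in $\mathbb{R}^d$, spanned by unit vectors $v_1,\dots,v_n\in\mathbb{R}^d$, is called equiangular if there is a constant $\alpha\geq 0$ such that $|\langle v_i,v_j\rangle|=\alpha$ for all $i\neq j$, $i,j\in\{1,\dots,n\}$, where $\langle\cdot,\cdot\rangle$ is the standard inner product. Because the lines are pairwise distinct, no two of the spanning unit vectors are equal or opposite. $N(d)$ is the maximum cardinality $n$ of a set of equiangular lines in $\mathbb{R}^d$. *)

(* Defs.v *)
From mathcomp Require Import all_boot all_order all_algebra.
From mathcomp Require Import boolp classical_sets reals.

Set Implicit Arguments.
Unset Strict Implicit.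
Unset Printing Implicit Defensive.

Import Order.TTheory GRing.Theory Num.Theory.

Local Open Scope classical_set_scope.
Local Open Scope ring_scope.

Definition dotv (R : realType) (d : nat) (u v : 'rV[R]_d) : R :=
  \sum_(k < d) u 0 k * v 0 k.

(* [v] lists unit vectors; the lines are the subspaces [<[v i]>%VS], and the
   injectivity condition says that these n lines are pairwise distinct. *)
Definition equiangular (R : realType) (d n : nat) (v : 'I_n -> 'rV[R]_d) : Prop :=
  [/\ forall i, dotv (v i) (v i) = 1,
      injective (fun i => <[v i]>%VS)
    & exists2 alpha : R, 0 <= alpha &
        forall i j, i != j -> `|dotv (v i) (v j)| = alpha].

Definition equiangular_cards (R : realType) (d : nat) : set nat :=
  [set n | exists v : 'I_n -> 'rV[R]_d, equiangular v].

(* N(d), the maximum of [equiangular_cards R d]. The default value 0 is returned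
   only if there is no maximum, so a positive lower bound on this number includes
   the existence of the maximum. *)
Definition max_equiangular (R : realType) (d : nat) : nat :=
  xget 0%N [set N | equiangular_cards R d N /\ ubound (equiangular_cards R d) N].

(* Main.v *)
Require Import Defs.
From mathcomp Require Import all_boot all_order all_algebra.
From mathcomp Require Import boolp classical_sets reals.
From mathcomp Require Import lra.
From Stdlib Require Import Ascii String.

(** Lower bound: of the 276 equiangular lines in R^23 obtained from the Leech
    lattice, 56 lie in a common 18-dimensional subspace.  In a suitable
    orthogonal basis of that subspace, with squared lengths 1 (16 times), 2 and
    3, they are spanned by vectors with entries -1, 0, 1, of squared length 10
    and with pairwise inner products 2 or -2.

    Existence of the maximum (Gerzon): for unit vectors v_i spanning equiangular
    lines with constant alpha < 1, the d x d matrices v_i^T v_i have the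
    nonsingular Gram matrix (1 - alpha^2) I + alpha^2 J, where J is the all-ones
    matrix, so there are at most d^2 of them. *)

Set Implicit Arguments.
Unset Strict Implicit.
Unset Printing Implicit Defensive.

Import Order.TTheory GRing.Theory Num.Theory.

Local Open Scope classical_set_scope.
Local Open Scope ring_scope.

Section Gerzon.
Variables (R : realType) (d : nat).
Implicit Types u v : 'rV[R]_d.

Lemma dotvE u v : dotv u v = (u *m v^T) 0 0.
Proof. by rewrite mxE; apply: eq_bigr => k _; rewrite mxE. Qed.

Lemma dotvC u v : dotv u v = dotv v u.
Proof. by apply: eq_bigr => k _; rewrite mulrC. Qed.

Lemma dotvZr a u v : dotv u (a *: v) = a * dotv u v.
Proof. by rewrite !dotvE linearZ -scalemxAr mxE. Qed.

Lemma dotvBB u v : dotv (u - v) (u - v) = dotv u u - 2 * dotv u v + dotv v v.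
Proof.
have -> : 2 * dotv u v = dotv u v + dotv v u by rewrite (dotvC v) mulr2n mulrDl mul1r.
by rewrite !dotvE linearB mulmxBl !mulmxBr !mxE; lra.
Qed.

(** The inequality is the form met below, where the squared length of [u - v] is 2 - 2<u,v> with
    <u,v> >= 1. *)
Lemma dotv_eq0 u : dotv u u <= 0 -> u = 0.
Proof.
move=> u_le0; apply/rowP => k; rewrite mxE.
have sq_ge0 (j : 'I_d) : true -> 0 <= u 0 j * u 0 j by rewrite -expr2 sqr_ge0.
have/eqP : dotv u u = 0 by apply/eqP; rewrite eq_le u_le0 sumr_ge0.
rewrite psumr_eq0 // => /allP/(_ k (mem_index_enum _)).
by rewrite /= mulf_eq0 orbb => /eqP.
Qed.

Lemma vline_eq_dotv u v :
  dotv u u = 1 -> dotv v v = 1 -> <[u]>%VS = <[v]>%VS -> `|dotv u v| = 1.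
Proof.
move=> u1 v1 eq_uv; have /vlineP[a v_au] : v \in <[u]>%VS by rewrite eq_uv memv_line.
have a2 : `|a| ^+ 2 = 1.
  rewrite real_normK ?num_real // expr2; move: v1.
  by rewrite v_au dotvZr dotvC dotvZr u1 mulr1.
rewrite v_au dotvZr u1 mulr1; apply/eqP.
by rewrite -(@pexpr_eq1 _ _ 2) // a2.
Qed.

(** Equality case of Cauchy-Schwarz: if |<u,v>| >= 1, then [u - v] or [u + v] has squared length 2 -
    2|<u,v>| <= 0, so u and v span the same line. *)
Lemma dotv_lt1 u v :
  dotv u u = 1 -> dotv v v = 1 -> <[u]>%VS <> <[v]>%VS -> `|dotv u v| < 1.
Proof.
move=> u1 v1 neq_uv; rewrite ltNge; apply/negP => dot_ge1; apply: neq_uv.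
have [dot_ge0|dot_lt0] := leP 0 (dotv u v).
  rewrite ger0_norm // in dot_ge1.
  suff /eqP : u - v = 0 by rewrite subr_eq0 => /eqP ->.
  by apply: dotv_eq0; rewrite dotvBB u1 v1; lra.
rewrite ltr0_norm // in dot_ge1.
have dotvN : dotv u (- v) = - dotv u v by rewrite -scaleN1r dotvZr mulN1r.
suff /eqP : u - - v = 0.
  rewrite subr_eq0 => /eqP ->; apply/eqP; rewrite eqEsubv -!memvE.
  by rewrite memvN memv_line /= -[X in X \in _]opprK memvN memv_line.
apply: dotv_eq0; rewrite dotvBB u1 dotvN.
have -> : dotv (- v) (- v) = 1 by rewrite -scaleN1r dotvZr dotvC dotvZr v1; lra.
by lra.
Qed.

Lemma equiangular_bound n (v : 'I_n -> 'rV[R]_d) : equiangular v -> (n <= d * d)%N.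
Proof.
case=> v1 v_inj [a0 a0_ge0 dot_a0].
(* For n <= 1 the angle condition is vacuous and [a0] may be 1 or more; it is then replaced by 0.
   Two distinct indices would contradict [dotv_lt1]. *)
have [a a2_lt1 dot_a] : exists2 a : R, a ^+ 2 < 1 &
    forall i j, i != j -> dotv (v i) (v j) ^+ 2 = a ^+ 2.
  have [a0_lt1|a0_ge1] := ltP a0 1.
    exists a0; first by rewrite expr_lt1.
    by move=> i j /dot_a0 <-; rewrite real_normK ?num_real.
  exists 0 => [|i j ij]; first by rewrite expr0n ltr01.
  suff : `|dotv (v i) (v j)| < 1 by rewrite dot_a0 // ltNge a0_ge1.
  by apply: dotv_lt1 => // /v_inj eq_ij; rewrite eq_ij eqxx in ij.
pose P : 'M[R]_(n, d * d) := \matrix_i mxvec ((v i)^T *m v i).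
have PPT : P *m P^T = (1 - a ^+ 2)%:M + a ^+ 2 *: const_mx 1.
  apply/matrixP => i j.
  (* The entrywise inner product of v_i^T v_i and v_j^T v_j is v_i (v_j^T v_j) v_i^T. *)
  have -> : (P *m P^T) i j = dotv (v i) (v j) ^+ 2.
    transitivity ((row i P *m (row j P)^T) 0 0).
      by rewrite !mxE; apply: eq_bigr => k _; rewrite !mxE.
    rewrite !rowK mxvec_dotmul mulmxA -mulmxA [LHS]mxE big_ord1.
    by rewrite -!dotvE (dotvC (v j)) expr2.
  rewrite !mxE mulr1; have [<-|/dot_a ->] := eqVneq i j; last by rewrite add0r.
  by rewrite v1 expr1n mulr1n subrK.
have -> : n = \rank P; last exact: rank_leq_col.
apply/esym/eqP; apply: inj_row_free => x xP0.
have eq0 j : (1 - a ^+ 2) * x 0 j + a ^+ 2 * \sum_i x 0 i = 0.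
  have /rowP/(_ j) : x *m (P *m P^T) = 0 by rewrite mulmxA xP0 mul0mx.
  rewrite PPT mulmxDr mul_mx_scalar -scalemxAr !mxE.
  by under eq_bigr do rewrite mxE mulr1.
have a2_ge0 := sqr_ge0 a.
(* Adding up the n equations [eq0] multiplies the sum of the x_i by (1 - a^2) + n a^2 > 0. *)
have sum0 : \sum_i x 0 i = 0.
  have : \sum_(j < n) ((1 - a ^+ 2) * x 0 j + a ^+ 2 * \sum_i x 0 i) = 0.
    by rewrite big1.
  rewrite big_split /= -mulr_sumr sumr_const card_ord -mulrnAl -mulrDl.
  move/eqP; rewrite mulf_eq0 => /orP[|/eqP//].
  by rewrite gt_eqF // ltr_wpDr ?mulrn_wge0 ?subr_gt0.
apply/rowP => j; rewrite mxE; have /eqP := eq0 j.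
by rewrite sum0 mulr0 addr0 mulf_eq0 subr_eq0 gt_eqF // => /eqP.
Qed.

(** Gerzon's bound makes the nonempty set of cardinalities bounded, so its maximum exists and [xget]
    does not return its default 0. *)
Lemma leq_max_equiangular n : equiangular_cards R d n -> (n <= max_equiangular R d)%N.
Proof.
move=> card_n.
have bounded m : `[< equiangular_cards R d m >] -> (m <= d * d)%N.
  by move=> /asboolP[v]; apply: equiangular_bound.
have ex_card : exists m, `[< equiangular_cards R d m >] by exists n; apply/asboolP.
case: (ex_maxnP ex_card bounded) => N /asboolP card_N max_N.
have : exists N, [set N | equiangular_cards R d N /\ ubound (equiangular_cards R d) N] N.
  by exists N; split=> // m card_m; apply/max_N/asboolP.
by move=> /(xgetPex 0%N)[_ /(_ n card_n)].
Qed.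

End Gerzon.

(** One row per vector, one column per basis vector; the last two columns belong to the basis
    vectors of squared length 2 and 3. *)
Definition sign_table : seq string := [::
   "-0+00+-0-+--++0000"; "+0-00--0++--++0000"; "0+0+--0---0-++0000";
   "0-0-+-0+--0-++0000"; "0+0-++0-+-0-++0000"; "0-0+-+0++-0-++0000";
   "+0-00++0-++-++0000"; "-0+00-+0+++-++0000"; "+--000+-0--+++0000";
   "-++000++0--+++0000"; "-+---00-0+0+++0000"; "+++++00-0+0+++0000";
   "+-+--00+0+0+++0000"; "---++00+0+0+++0000"; "--+000--0-++++0000";
   "++-000-+0-++++0000"; "0--0-+000+-0+--+00"; "-00-0-+-0-00+--+00";
   "0+++0+-00-00+--+00"; "+000+-0+0++0+--+00"; "+-00+000-+-0-+-+00";
   "-+0-00-0--00-+-+00"; "00++00+-+-00-+-+00"; "00-0-00++++0-+-+00";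
   "--0+0--0000-+-++00"; "00+-0+++000-+-++00"; "0+-0+000+0-++-++00";
   "+000-00--0+++-++00"; "-00+00++-00--+++00"; "0-+-00-0+00--+++00";
   "++00--0000-+-+++00"; "00-0++0-00++-+++00"; "00--000--0--00--+0";
   "++0+0000+0+-00--+0"; "0-+0+-+0000+00--+0"; "-000-+-+000+00--+0";
   "00-+0-0+0--000+-+0"; "00+0----0+0000+-+0"; "-+00+++00+0000+-+0";
   "+-0-0+000-+000+-+0"; "0++-0000++-000-++0"; "+000-0++--0000-++0";
   "0--0+0-0+-0000-++0"; "-00+000--++000-++0"; "++00+0-0-00-00+++0";
   "00-0-0+-+00-00+++0"; "0-++0+0000-+00+++0"; "-00-0-0+00++00+++0";
   "0+-0-000+--000-00+"; "-00-00++-+0000-00+"; "0-++00-0++0000-00+";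
   "+000+00---+000-00+"; "+-00-000-0--00+00+"; "00-0+00++0+-00+00+";
   "-00+0-+-000+00+00+"; "0++-0+-0000+00+00+"]%string.

Definition int_of_sign (c : ascii) : int :=
  match c with "+"%char => 1 | "-"%char => -1 | _ => 0 end.

Definition coord (i k : nat) : int :=
  if String.get k (nth ""%string sign_table i) is Some c then int_of_sign c else 0.

Definition weight (k : nat) : int :=
  if k == 16%N then 2 else if k == 17%N then 3 else 1.

Lemma weight_ge0 k : 0 <= weight k.
Proof. by rewrite /weight; case: ifP => // _; case: ifP. Qed.

(** An integer [foldr] over an explicit list, so that all inner products can be checked by
    computation. *)
Definition gram (i j : nat) : int :=
  foldr +%R 0 [seq weight k * (coord i k * coord j k) | k <- iota 0 18].

Lemma gramE i j : gram i j = \sum_(k < 18) weight k * (coord i k * coord j k).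
Proof. by rewrite /gram foldrE big_map -[iota 0 18]/(index_iota 0 18) big_mkord. Qed.

Lemma gram_table :
  all (fun i => all (fun j => if i == j then gram i j == 10 else `|gram i j| == 2)
                    (iota 0 56)) (iota 0 56).
Proof. by vm_compute. Qed.

Lemma gram_diag i : (i < 56)%N -> gram i i = 10.
Proof.
move=> i_lt; move/allP: gram_table => /(_ i); rewrite mem_iota => /(_ i_lt).
by move=> /allP/(_ i); rewrite mem_iota eqxx => /(_ i_lt)/eqP.
Qed.

Lemma norm_gram i j : (i < 56)%N -> (j < 56)%N -> i != j -> `|gram i j| = 2.
Proof.
move=> i_lt j_lt /negPf ij; move/allP: gram_table => /(_ i).
rewrite mem_iota => /(_ i_lt) /allP/(_ j).
by rewrite mem_iota ij => /(_ j_lt)/eqP.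
Qed.

Section Lines56.
Variable R : realType.

(** The square roots of the weights pass to an orthonormal basis; the division by 10 makes the
    vectors unit vectors. *)
Definition lines56 (i : 'I_56) : 'rV[R]_18 :=
  \row_k (Num.sqrt ((weight k)%:~R / 10) * (coord i k)%:~R).

Lemma dotv_lines56 i j : dotv (lines56 i) (lines56 j) = (gram i j)%:~R / 10.
Proof.
rewrite gramE rmorph_sum mulr_suml; apply: eq_bigr => k _.
rewrite !mxE mulrACA -expr2 sqr_sqrtr; last by rewrite divr_ge0 ?ler0z ?weight_ge0.
by rewrite !rmorphM /= mulrAC.
Qed.

Lemma equiangular_lines56 : equiangular lines56.
Proof.
have unit_lines i : dotv (lines56 i) (lines56 i) = 1.
  by rewrite dotv_lines56 gram_diag // divff // pnatr_eq0.
have dot_lines i j : i != j -> `|dotv (lines56 i) (lines56 j)| = 1 / 5.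
  move=> ij; rewrite dotv_lines56 normrM -intr_norm norm_gram //.
  by rewrite ger0_norm ?invr_ge0 ?ler0n //; lra.
split=> // [i j eq_ij|].
  (* Coinciding lines would give absolute inner product 1 instead of 1/5. *)
  apply/eqP/negPn/negP => /dot_lines.
  by rewrite (vline_eq_dotv _ _ eq_ij) // {eq_ij} => ?; lra.
by exists (1 / 5) => //; lra.
Qed.

End Lines56.

Theorem theorem1p1 (R : realType) : (54 <= max_equiangular R 18)%N.
Proof.
apply: (@leq_trans 56) => //; apply: leq_max_equiangular.
by exists (@lines56 R); apply: equiangular_lines56.
Qed.
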